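(* Let $R=UZ^T=\sum_{i=1}^r\sigma_iu_iv_i^T\in\mathscr{M}$ and let $N=\sum_{j=1}^k\sigma_{r+j}u_{r+j}v_{r+j}^T\in\mathcal{N}(R)$ be a normal vector, where $k=\mathrm{rank}(N)$, $(u_i)_{1\le i\le l}$ is an orthonormal basis of $\mathbb{R}^l$, $(v_i)_{1\le i\le m}$ is an orthonormal basis of $\mathbb{R}^m$, and $\sigma_1,\dots,\sigma_{r+k}>0$ (no ordering of the singular values is assumed). At $R$ and in the normal direction $N$, there are $2kr$ non-zero principal curvatures (counted with multiplicity) $$\kappa_{i,j}^{\pm}(N)=\pm\frac{\sigma_{r+j}}{\sigma_i},\qquad 1\le i\le r,\ 1\le j\le k,$$ and the corresponding normalized principal directions are the tangent vectors $$\Phi_{i,r+j}^{\pm}=\frac{1}{\sqrt2}\left(u_{r+j}v_i^T\pm u_iv_{r+j}^T\right).$$ The other principal curvatures are zero and are associated with the principal subspace $$\mathrm{Ker}(L_R(N))=\mathrm{span}\{u_iv^T : 1\le i\le r,\ Nv=0\}\oplus\mathrm{span}\{uv_i^T : 1\le i\le r,\ u^TN=0,\ u^TU=0\}.$$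
   Context: $\mathcal{M}_{l,m}$ is the space of $l\times m$ real matrices with the Frobenius inner product $\langle A,B\rangle=\mathrm{Tr}(A^TB)$. $\mathscr{M}=\{R\in\mathcal{M}_{l,m} : \mathrm{rank}(R)=r\}$ is the fixed rank manifold, an embedded submanifold of dimension $(l+m)r-r^2$. Points are written $R=UZ^T$ with $U\in\mathcal{M}_{l,r}$, $U^TU=I$, $Z\in\mathcal{M}_{m,r}$, $\mathrm{rank}(Z)=r$. $\mathcal{T}(R)$ is the tangent space at $R$, $\Pi_{\mathcal{T}(R)}$ the orthogonal projection of $\mathcal{M}_{l,m}$ onto it, and $\mathcal{N}(R)=\{N\in\mathcal{M}_{l,m} : U^TN=0,\ NZ=0\}$ is its orthogonal complement (the normal space). For $N\in\mathcal{N}(R)$, the Weingarten map $L_R(N):\mathcal{T}(R)\to\mathcal{T}(R)$ in the normal direction $N$ is the symmetric linear map $$L_R(N)X=\left[\left.\frac{d}{dt}\Pi_{\mathcal{T}(R(t))}\right|_{t=0}\right](N),$$ where $R(t)$ is any smooth curve on $\mathscr{M}$ with $R(0)=R$, $\dot R(0)=X$. Its eigenvalues and eigenvectors are called the principal curvatures and principal directions of $\mathscr{M}$ at $R$ in the normal direction $N$ ($N$ is not required to have unit norm). *)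

(* Defs.v *)
From HB Require Import structures.
From mathcomp Require Import all_boot all_order all_algebra.
From mathcomp Require Import all_classical all_reals all_analysis.
Import Order.TTheory GRing.Theory Num.Theory.
Import numFieldNormedType.Exports.

Set Implicit Arguments.
Unset Strict Implicit.
Unset Printing Implicit Defensive.

Local Open Scope classical_set_scope.
Local Open Scope ring_scope.

Section Subspaces.
Variables (K : fieldType) (vT : vectType K).

(* The subspace with carrier S; 0 if S is not (the carrier of) a subspace. *)
Definition vspace_of (S : set vT) : {vspace vT} :=
  xget 0%VS [set E : {vspace vT} | forall x, x \in E <-> S x].

Definition set_span (S : set vT) : {vspace vT} :=
  vspace_of [set x | exists2 s : seq vT,
    (forall y, y \in s -> S y) & x \in span s].

(* A subspace of the subspace T, seen in the ambient space. *)
Definition ambient (T : {vspace vT}) (E : {vspace subvs_of T}) : {vspace vT} :=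
  (linfun (vsval : subvs_of T -> vT) @: E)%VS.

Lemma set_spanP (S : set vT) (x : vT) :
  x \in set_span S <->
  exists2 s : seq vT, (forall y, y \in s -> S y) & x \in span s.
Proof.
rewrite /set_span /vspace_of; case: xgetP => [E -> HE|]; first exact: HE.
move=> none.
have step n : exists2 s : seq vT, (forall y, y \in s -> S y)
    & (n <= \dim (span s))%N.
  elim: n => [|n [s Ss les]]; first by exists [::].
  apply: contrapT => nos; apply: (none (span s)) => y; split=> [ys|[t St yt]].
    by exists s.
  apply/negPn/negP => yNs; apply: nos; exists (s ++ t).
    by move=> z; rewrite mem_cat => /orP[/Ss|/St].
  rewrite span_cat (leq_ltn_trans les)// ltn_neqAle dimvS ?addvSl// andbT.
  apply: contra yNs => /eqP e.
  have /eqP -> : (span s == span s + span t)%VS by rewrite eqEdim addvSl e leqnn.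
  exact: subvP (addvSr _ _) _ yt.
have [s _] := step (\dim {:vT}).+1.
by rewrite leqNgt ltnS dimvS ?subvf.
Qed.

End Subspaces.

Section FixedRankManifold.
Variables (R : realType) (l m : nat).
Implicit Types (A B N X : 'M[R]_(l, m)) (E : {vspace 'M[R]_(l, m)}).

Definition fixed_rank (r : nat) : set 'M[R]_(l, m) := [set A | \rank A = r].

(* c is C^infinity and takes values in the rank-r manifold near t = 0, with
   c(0) = A and c'(0) = X. *)
Definition smooth_curve (r : nat) A X (c : R -> 'M[R]_(l, m)) : Prop :=
  [/\ \forall t \near (0 : R),
        fixed_rank r (c t) /\ forall n, derivable (derive1n n c) t 1,
      c 0 = A & derive1 c 0 = X].

Definition tangent_vector (r : nat) A X : Prop :=
  exists c : R -> 'M[R]_(l, m), smooth_curve r A X c.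

Definition tangent_space (r : nat) A : {vspace 'M[R]_(l, m)} :=
  vspace_of [set X | tangent_vector r A X].

Definition normal_directions (r : nat) (U : 'M[R]_(l, r)) (Z : 'M[R]_(m, r)) :
    set 'M[R]_(l, m) :=
  [set N | U^T *m N = 0 /\ N *m Z = 0].

End FixedRankManifold.

Definition frob (R : realType) (p q : nat) (A B : 'M[R]_(p, q)) : R :=
  \tr (A^T *m B).

Definition orthonormal_basis (R : realType) (n : nat) (b : 'I_n -> 'cV[R]_n) :
    Prop :=
  (forall i j, frob (b i) (b j) = (i == j)%:R) /\
  basis_of {:'cV[R]_n} [tuple b i | i < n].

Section Weingarten.
Variables (R : realType) (l m : nat).
Implicit Types (A N X : 'M[R]_(l, m)) (E : {vspace 'M[R]_(l, m)}).

(* Orthogonal for the Frobenius inner product. *)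
Definition orth_proj E X : 'M[R]_(l, m) :=
  xget 0 [set P | P \in E /\ forall Y, Y \in E -> frob (X - P) Y = 0].

(* Differentiating along any smooth curve through A with velocity X gives L X. *)
Definition is_weingarten (r : nat) A N
    (L : 'End(subvs_of (tangent_space r A))) : Prop :=
  forall (X : subvs_of (tangent_space r A)) (c : R -> 'M[R]_(l, m)),
    smooth_curve r A (vsval X) c ->
    is_derive (0 : R) 1 (fun t => orth_proj (tangent_space r (c t)) N)
      (vsval (L X)).

Definition weingarten (r : nat) A N : 'End(subvs_of (tangent_space r A)) :=
  xget 0 [set L | is_weingarten N L].

End Weingarten.

Arguments is_weingarten {R l m} r A N L.

Section PrincipalCurvatures.
Variables (R : realType) (l m r k : nat).
Variables (rkl : (r + k <= l)%N) (rkm : (r + k <= m)%N).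
Variables (sigma : 'I_(r + k) -> R).
Variables (u : 'I_l -> 'cV[R]_l) (v : 'I_m -> 'cV[R]_m).

(* u_i, v_i, sigma_i for the first r indices, and u_{r+j}, v_{r+j},
   sigma_{r+j} for the next k ones. *)
Definition u1 (i : 'I_r) : 'cV[R]_l := u (widen_ord rkl (lshift k i)).
Definition u2 (j : 'I_k) : 'cV[R]_l := u (widen_ord rkl (rshift r j)).
Definition v1 (i : 'I_r) : 'cV[R]_m := v (widen_ord rkm (lshift k i)).
Definition v2 (j : 'I_k) : 'cV[R]_m := v (widen_ord rkm (rshift r j)).
Definition sigma1 (i : 'I_r) : R := sigma (lshift k i).
Definition sigma2 (j : 'I_k) : R := sigma (rshift r j).

(* In both definitions the boolean s encodes the sign (-1)^s. *)
Definition kappa (s : bool) (i : 'I_r) (j : 'I_k) : R :=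
  (-1) ^+ s * (sigma2 j / sigma1 i).

Definition Phi (s : bool) (i : 'I_r) (j : 'I_k) : 'M[R]_(l, m) :=
  (Num.sqrt 2)^-1 *:
    (u2 j *m (v1 i)^T + (-1) ^+ s *: (u1 i *m (v2 j)^T)).

End PrincipalCurvatures.

(* Main.v *)
Require Import Defs.
From HB Require Import structures.
From mathcomp Require Import all_boot all_order all_algebra.
From mathcomp Require Import all_classical all_reals all_analysis.
From mathcomp Require Import ring.
Import Order.TTheory GRing.Theory Num.Theory.
Import numFieldNormedType.Exports.

Set Implicit Arguments.
Unset Strict Implicit.
Unset Printing Implicit Defensive.

Local Open Scope classical_set_scope.
Local Open Scope ring_scope.

(** Let [P] and [Q] be the orthogonal projections onto the column and row spaces
    of [A].  A rank [r] matrix near [A] equals the product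
    [C V (W C V)^-1 W C] for fixed [W], [V], so a tangent vector [X] satisfies
    [(1 - P) X (1 - Q) = 0]; conversely such an [X] is the velocity of an explicit
    quadratic curve.  Hence the projection of [N] onto the tangent space is
    [N - (1 - P) N (1 - Q)], and differentiating [P] and [Q] along a curve gives
    [L X = B X^T N + N X^T B] where [B = \sum_i (sigma_i)^-1 u_i v_i^T] is the
    transpose of the pseudoinverse of [A].  Expanding [B] and [N] turns [L] into
    [\sum_p kappa_p <Phi_p, X> Phi_p] with orthonormal [Phi_p], from which the
    eigenspaces and the kernel are read off. *)

(** * Differential calculus for matrix-valued functions of a real variable *)

Section MatrixCalculus.
Variable R : realType.

Lemma is_derive_mxP (p q : nat) (t : R) (F : R -> 'M[R]_(p, q)) D :
  is_derive t 1 F D <->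
  forall i j, is_derive t (1 : R) (fun s => F s i j) (D i j).
Proof.
split=> [[dF <-] i j|dF].
  have dFij := (derivable_mxP _ _ _).1 dF i j.
  by apply: DeriveDef => //; rewrite derive_mx// mxE.
have dF' : derivable F t 1 by apply/derivable_mxP => i j; case: (dF i j).
apply: DeriveDef => //; rewrite derive_mx//; apply/matrixP => i j.
by rewrite mxE; case: (dF i j).
Qed.

Lemma is_derive_mulmx (p q s : nat) (t : R) (F : R -> 'M[R]_(p, q))
    (G : R -> 'M[R]_(q, s)) dF dG :
  is_derive t 1 F dF -> is_derive t 1 G dG ->
  is_derive t 1 (fun x => F x *m G x) (dF *m G t + F t *m dG).
Proof.
move=> /is_derive_mxP hF /is_derive_mxP hG; apply/is_derive_mxP => i j.
rewrite (_ : (fun x => _) = \sum_k ((fun x => F x i k) * (fun x => G x k j))).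
  apply: is_derive_eq; rewrite !mxE -big_split/=; apply: eq_bigr => k _.
  by rewrite addrC /GRing.scale/= [G t k j * _]mulrC.
by apply/funext => x; rewrite mxE fct_sumE.
Qed.

Lemma is_derive_trmx (p q : nat) (t : R) (F : R -> 'M[R]_(p, q)) dF :
  is_derive t 1 F dF -> is_derive t 1 (fun x => (F x)^T) dF^T.
Proof.
move=> /is_derive_mxP hF; apply/is_derive_mxP => i j; rewrite mxE.
by under [X in is_derive _ _ X _]eq_fun do rewrite mxE; exact: hF.
Qed.

Lemma derivable_bigprod (I : Type) (s : seq I) (h : I -> R -> R) (t : R) :
  (forall i, derivable (h i) t 1) ->
  derivable (fun x => \prod_(i <- s) h i x) t 1.
Proof.
move=> dh; elim: s => [|i s IH].
  by under [X in derivable X]eq_fun do rewrite big_nil; exact: derivable_cst.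
under [X in derivable X]eq_fun do rewrite big_cons.
exact: derivableM.
Qed.

Lemma derivable_bigsum (I : Type) (s : seq I) (h : I -> R -> R) (t : R) :
  (forall i, derivable (h i) t 1) ->
  derivable (fun x => \sum_(i <- s) h i x) t 1.
Proof.
move=> dh; elim: s => [|i s IH].
  by under [X in derivable X]eq_fun do rewrite big_nil; exact: derivable_cst.
under [X in derivable X]eq_fun do rewrite big_cons.
exact: derivableD.
Qed.

Lemma derivable_det n (t : R) (F : R -> 'M[R]_n) :
  (forall i j, derivable (fun x => F x i j) t 1) ->
  derivable (fun x => \det (F x)) t 1.
Proof.
move=> dF; apply: derivable_bigsum => s.
by apply: derivableM; [exact: derivable_cst|exact: derivable_bigprod].
Qed.

(** The determinant is continuous at [t], hence stays nonzero nearby. *)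
Lemma near_unitmx n (t : R) (F : R -> 'M[R]_n) :
  derivable F t 1 -> F t \in unitmx -> \forall x \near t, F x \in unitmx.
Proof.
move=> /derivable_mxP dF; rewrite unitmxE unitfE => det0.
have /derivable1_diffP/differentiable_continuous cdet := derivable_det dF.
by near do rewrite unitmxE unitfE; exact: (cvgr_neq0 _ cdet).
Unshelve. all: by end_near. Qed.

(** [invmx] is defined by cases on invertibility, but near [t] it coincides with the adjugate over
    the determinant, whose entries are visibly derivable. *)
Lemma derivable_invmx n (t : R) (F : R -> 'M[R]_n) :
  derivable F t 1 -> F t \in unitmx -> derivable (fun x => invmx (F x)) t 1.
Proof.
move=> dF Ft; have Fu := near_unitmx dF Ft.
move: dF Ft => /derivable_mxP dF; rewrite unitmxE unitfE => det0.
have ddet := derivable_det dF.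
suff : derivable (fun x => (\det (F x))^-1 *: \adj (F x)) t 1.
  apply: near_eq_derivable; near=> x; rewrite /invmx.
  by have -> : F x \in unitmx by near: x.
apply/derivable_mxP => i j.
under [X in derivable X]eq_fun do rewrite !mxE.
apply: derivableM; first exact: derivableV.
apply: derivableM; first exact: derivable_cst.
apply: derivable_det => i' j'.
by under [X in derivable X]eq_fun do rewrite !mxE; exact: dF.
Unshelve. all: by end_near. Qed.

(** Derivability being known, the value comes from differentiating [F x *m invmx (F x)], which is
    constantly 1 near [t]. *)
Lemma is_derive_invmx n (t : R) (F : R -> 'M[R]_n) dF :
  is_derive t 1 F dF -> F t \in unitmx ->
  is_derive t 1 (fun x => invmx (F x)) (- (invmx (F t) *m dF *m invmx (F t))).
Proof.
move=> hF Ft; have [dF' _] := hF.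
have /derivableP := derivable_invmx dF' Ft; set D := 'D_1 _ t => hI.
suff -> : - (invmx (F t) *m dF *m invmx (F t)) = D by [].
have h1 : is_derive t 1 (fun x => F x *m invmx (F x)) 0.
  apply: (@near_eq_is_derive _ _ _ (cst 1%:M)).
  by near=> x; rewrite mulmxV//; near: x; exact: near_unitmx.
have [_ e1] := h1; have [_] := is_derive_mulmx hF hI; rewrite e1 => e.
have -> : D = invmx (F t) *m (F t *m D) by rewrite mulmxA mulVmx// mul1mx.
have -> : F t *m D = - (dF *m invmx (F t)).
  by apply/eqP; rewrite -addr_eq0 addrC -e.
by rewrite mulmxN mulmxA.
Unshelve. all: by end_near. Qed.

Section QuadraticCurve.
Variables (p q : nat) (A B C : 'M[R]_(p, q)).

Let quad (a b c : 'M[R]_(p, q)) (t : R) := a + t *: b + t ^+ 2 *: c.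

Let is_derive_quad a b c (t : R) :
  is_derive t (1 : R) (quad a b c) (quad b (2 *: c) 0 t).
Proof.
apply/is_derive_mxP => i j; rewrite /quad.
rewrite (_ : (fun s => _) =
    cst (a i j) + (id * cst (b i j)) + (id ^+ 2) * cst (c i j)).
  apply: is_derive_eq; rewrite /= !mxE /GRing.scale/= /cst/=.
  by ring.
by apply/funext => s; rewrite !mxE.
Qed.

Let derive_quad a b c : derive1 (quad a b c) = quad b (2 *: c) 0.
Proof. by apply/funext => t; rewrite derive1E; case: (is_derive_quad a b c t).
  Qed.

Lemma derive1_quadratic : derive1 (quad A B C) 0 = B.
Proof. by rewrite derive_quad /quad expr0n/= !scale0r !addr0. Qed.

(** Quadratics are closed under differentiation, so every iterated derivative is again a [quad]. *)
Lemma derivable_quadratic n t : derivable (derive1n n (quad A B C)) t 1.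
Proof.
have [a [b [c ->]]] : exists a b c, derive1n n (quad A B C) = quad a b c.
  elim: n => [|n [a [b [c IH]]]]; first by exists A, B, C.
  by exists b, (2 *: c), 0; rewrite derive1nS IH derive_quad.
by case: (is_derive_quad a b c t).
Qed.

End QuadraticCurve.

End MatrixCalculus.

(** * The Frobenius inner product and orthogonal projection *)

Section Frobenius.
Variables (R : realType) (p q : nat).
Implicit Types A B C : 'M[R]_(p, q).

Lemma frobE A B : frob A B = \sum_i \sum_j A i j * B i j.
Proof.
rewrite /frob /mxtrace exchange_big/=; apply: eq_bigr => j _.
by rewrite mxE; apply: eq_bigr => i _; rewrite mxE.
Qed.

Lemma frobC A B : frob A B = frob B A.
Proof. by rewrite /frob -mxtrace_tr trmx_mul trmxK. Qed.

Lemma frobDl A B C : frob (A + B) C = frob A C + frob B C.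
Proof. by rewrite /frob linearD/= mulmxDl linearD. Qed.

Lemma frobZl a A B : frob (a *: A) B = a * frob A B.
Proof. by rewrite /frob linearZ/= -scalemxAl linearZ. Qed.

Lemma frobBl A B C : frob (A - B) C = frob A C - frob B C.
Proof. by rewrite -scaleN1r frobDl frobZl mulN1r. Qed.

Lemma frobDr A B C : frob A (B + C) = frob A B + frob A C.
Proof. by rewrite frobC frobDl !(frobC A). Qed.

Lemma frobZr a A B : frob A (a *: B) = a * frob A B.
Proof. by rewrite frobC frobZl frobC. Qed.

Lemma frob_eq0 A : frob A A = 0 -> A = 0.
Proof.
rewrite frobE => /eqP; rewrite psumr_eq0 => [/allP h|i _]; last first.
  by apply: sumr_ge0 => j _; rewrite -expr2 sqr_ge0.
apply/matrixP => i j; rewrite mxE; have := h i (mem_index_enum _) => /=.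
rewrite psumr_eq0 => [/allP/(_ j (mem_index_enum _))/=|j' _].
  by rewrite mulf_eq0 orbb => /eqP.
by rewrite -expr2 sqr_ge0.
Qed.

(** Two candidates [B] and [B'] differ by an element of [E] that is also orthogonal to [E], hence to
    itself; positive definiteness makes it zero. *)
Lemma orth_projP (E : {vspace 'M[R]_(p, q)}) A B :
  B \in E -> (forall C, C \in E -> frob (A - B) C = 0) -> orth_proj E A = B.
Proof.
move=> EB AB; rewrite /orth_proj; case: xgetP => [B' _ [EB' AB']|none];
  last first.
  by case: (none B).
apply/eqP; rewrite -subr_eq0; apply/eqP; apply: frob_eq0.
have ED : B' - B \in E by rewrite memvB.
have e : B' - B = (A - B) - (A - B').
  by apply/matrixP => i j; rewrite !mxE; ring.
by rewrite {1}e frobBl AB// AB'// subrr.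
Qed.

End Frobenius.

(** * Factorizations of a matrix of given rank *)

Section RankFactorization.
Variable F : fieldType.

(** [W] and [V] are one-sided inverses of the two factors of a full rank factorization. They provide
    an r by r compression whose invertibility persists near [M]. *)
Lemma mxrank_inverse (l m : nat) (M : 'M[F]_(l, m)) :
  exists (W : 'M[F]_(\rank M, l)) (V : 'M[F]_(m, \rank M)), W *m M *m V = 1%:M.
Proof.
exists (pinvmx (col_base M)), (pinvmx (row_base M)).
have -> : pinvmx (col_base M) *m M = pinvmx (col_base M) *m (col_base M *m
  row_base M).
  by rewrite mulmx_base.
rewrite [X in X *m _]mulmxA mulVpmx ?col_base_full// mul1mx.
by rewrite mulmxVp// row_base_free.
Qed.

(** Write [C = a b] with inner dimension r. The square matrices [W a] and [b V K] are inverse on one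
    side, hence on the other, and [b V K W a = 1] can be inserted between [a] and [b]. *)
Lemma rank_schur (l m r : nat) (W : 'M[F]_(r, l)) (V : 'M[F]_(m, r))
    (C : 'M[F]_(l, m)) :
  \rank C = r -> W *m C *m V \in unitmx ->
  C *m V *m invmx (W *m C *m V) *m (W *m C) = C.
Proof.
move=> rC; have [a [b ->]] : exists (a : 'M[F]_(l, r)) (b : 'M[F]_(r, m)), C =
  a *m b.
  by case: _ / rC; exists (col_base C), (row_base C); rewrite mulmx_base.
set K := invmx _ => H.
have : (W *m a) *m (b *m V *m K) = 1%:M by rewrite -(mulmxV H) -/K !mulmxA.
move=> /mulmx1C e.
transitivity (a *m (b *m V *m K *m (W *m a)) *m b); first by rewrite !mulmxA.
by rewrite e mulmx1.
Qed.

(** Since invertibility of [W C V] is an open condition, this keeps the rank from dropping along a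
    curve near its base point. *)
Lemma rank_minor (l m r : nat) (W : 'M[F]_(r, l)) (V : 'M[F]_(m, r))
    (C : 'M[F]_(l, m)) : W *m C *m V \in unitmx -> (r <= \rank C)%N.
Proof.
move=> /mxrank_unit <-.
by apply: leq_trans (mxrankM_maxl _ _) (mxrankM_maxr _ _).
Qed.

End RankFactorization.

(** * The tangent space of the fixed rank manifold *)

Section TangentSpace.
Variables (R : realType) (l m r : nat).
Implicit Types M X : 'M[R]_(l, m).

Lemma tangent_vector_necessary (P : 'M[R]_l) (Q : 'M[R]_m) M X :
  \rank M = r -> P *m M = M -> M *m Q = M -> tangent_vector r M X ->
  (1%:M - P) *m X *m (1%:M - Q) = 0.
Proof.
move=> rM PM MQ [c [cnear c0 c'0]].
have dc : is_derive (0 : R) 1 c X.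
  rewrite -c'0 derive1E; apply: derivableP.
  by have [_ /(_ 0%N)] := nbhs_singleton cnear; rewrite derive1n0.
have PM0 : (1%:M - P) *m M = 0 by rewrite mulmxBl mul1mx PM subrr.
have MQ0 : M *m (1%:M - Q) = 0 by rewrite mulmxBr mulmx1 MQ subrr.
have [W [V WMV]] : exists (W : 'M[R]_(r, l)) (V : 'M[R]_(m, r)), W *m M *m V =
  1%:M.
  by case: _ / rM; exact: mxrank_inverse.
have dcst p q (C : 'M[R]_(p, q)) : is_derive (0 : R) 1 (cst C) 0 by exact:
  is_derive_cst.
have dWcV := is_derive_mulmx (is_derive_mulmx (dcst _ _ W) dc) (dcst _ _ V).
have u0 : W *m c 0 *m V \in unitmx by rewrite c0 WMV unitmx1.
have dI := is_derive_invmx dWcV u0.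
(* Near 0, [(1 - P) c (1 - Q)] is [(1 - P) c V * I * W c (1 - Q)], whose outer
   factors both vanish at 0, so its derivative at 0 is zero. *)
have dl := is_derive_mulmx (is_derive_mulmx (dcst _ _ (1%:M - P)) dc) (dcst _ _
  V).
have dr := is_derive_mulmx (is_derive_mulmx (dcst _ _ W) dc) (dcst _ _ (1%:M -
  Q)).
have d1 := is_derive_mulmx (is_derive_mulmx dl dI) dr.
have d2 := is_derive_mulmx (is_derive_mulmx (dcst _ _ (1%:M - P)) dc) (dcst _ _
  (1%:M - Q)).
have [_ e2] := d2.
have : is_derive (0 : R) 1
    (fun t => cst (1%:M - P) t *m c t *m cst (1%:M - Q) t) 0.
  apply: (near_eq_is_derive _ (is_derive_eq d1 (_ : _ = 0))); last first.
    by rewrite /= c0 PM0 -[W *m M *m (1%:M - Q)]mulmxA MQ0 !(mulmx0, mul0mx)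
      addr0.
  have [dWcV' _] := dWcV; have Hu := near_unitmx dWcV' u0.
  near=> t.
  have [rct _] : fixed_rank r (c t) /\ forall n, derivable (derive1n n c) t 1.
    by near: t.
  have Ht : W *m c t *m V \in unitmx by near: t.
  by rewrite /= -[in RHS](rank_schur rct Ht) !mulmxA.
by case=> _; rewrite e2 mul0mx add0r mulmx0 addr0.
Unshelve. all: by end_near. Qed.

(** [P M = M] and [P = M K] make [P] a projection, possibly oblique, onto the column space of [M];
    [Q] plays the same part for the row space. *)
Lemma tangent_vectorP (P : 'M[R]_l) (Q : 'M[R]_m) (K K1 : 'M[R]_(m, l)) M X :
  \rank M = r -> P *m M = M -> P = M *m K -> M *m Q = M -> Q = K1 *m M ->
  tangent_vector r M X <-> (1%:M - P) *m X *m (1%:M - Q) = 0.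
Proof.
move=> rM PM PMK MQ QKM; split; first exact: tangent_vector_necessary.
move=> X0.
have [W [V WMV]] : exists (W : 'M[R]_(r, l)) (V : 'M[R]_(m, r)), W *m M *m V =
  1%:M.
  by case: _ / rM; exact: mxrank_inverse.
(* Tangency means that the part of [X] outside the column space of [M] has its rows in the row space
   of [M]. *)
set Y := (1%:M - P) *m X.
have YQ : Y *m Q = Y by apply/esym/eqP; rewrite -subr_eq0 -{1}[Y]mulmx1
  -mulmxBr X0.
(* Expanding the factored form [cE], which makes the rank at most r; the linear
   term is [Y Q + P X = X]. *)
pose c (t : R) := M + t *: X + t ^+ 2 *: (Y *m K1 *m M *m K *m X).
have cE t : c t = (1%:M + t *: (Y *m K1)) *m M *m (1%:M + t *: (K *m X)).
  have MKX : M *m K *m X = P *m X by rewrite PMK.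
  have YK : Y *m K1 *m M = Y by rewrite -mulmxA -QKM.
  rewrite !(mulmxDl, mulmxDr) !mul1mx !mulmx1 -!scalemxAl -!scalemxAr scalerA
    -expr2.
  have eX : X = P *m X + Y by rewrite /Y mulmxBl mul1mx addrC subrK.
  rewrite !mulmxA MKX YK /c YK {1}eX.
  move: (P *m X) (Y *m K *m X) => a d.
  move: (Y) => b.
  by apply/matrixP => i j; rewrite !mxE; ring.
have c0 : c 0 = M by rewrite /c expr0n/= !scale0r !addr0.
exists c; split=> //; last exact: derive1_quadratic.
have dc : is_derive (0 : R) 1 c X.
  rewrite -(derive1_quadratic M X (Y *m K1 *m M *m K *m X)) derive1E.
  apply: derivableP; have : derivable (derive1n 0%N c) 0 1 by exact:
    derivable_quadratic.
  by rewrite derive1n0.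
have dcst p q (C : 'M[R]_(p, q)) : is_derive (0 : R) 1 (cst C) 0 by exact:
  is_derive_cst.
have [dWcV _] := is_derive_mulmx (is_derive_mulmx (dcst _ _ W) dc) (dcst _ _ V).
have u0 : W *m c 0 *m V \in unitmx by rewrite c0 WMV unitmx1.
have Hu := near_unitmx dWcV u0.
near=> t; split=> [|n]; last exact: derivable_quadratic.
have Ht : W *m c t *m V \in unitmx by near: t.
(* The invertible compression bounds the rank below by r, the factored form [cE] bounds it above. *)
apply/eqP; rewrite eqn_leq (rank_minor Ht) andbT -[X in (_ <= X)%N]rM cE.
by apply: leq_trans (mxrankM_maxl _ _) (mxrankM_maxr _ _).
Unshelve. all: by end_near. Qed.

(** [rank_schur] applied to [M] itself gives [M V W M = M], so [V W] is a generalized inverse of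
    [M], and its products with [M] are the required projections. *)
Lemma tangent_projectors M : \rank M = r ->
  exists (P : 'M[R]_l) (Q : 'M[R]_m) (K K1 : 'M[R]_(m, l)),
  [/\ P *m M = M, P = M *m K, M *m Q = M & Q = K1 *m M].
Proof.
move=> rM.
have [W [V WMV]] : exists (W : 'M[R]_(r, l)) (V : 'M[R]_(m, r)), W *m M *m V =
  1%:M.
  by case: _ / rM; exact: mxrank_inverse.
have := @rank_schur _ _ _ _ W V M rM; rewrite WMV => /(_ (unitmx1 _ _)).
rewrite invmx1 mulmx1 => MVWM.
exists (M *m (V *m W)), (V *m W *m M), (V *m W), (V *m W).
by split; rewrite // -?mulmxA// mulmxA.
Qed.

(** [vspace_of] falls back to 0 on a set that is not a subspace. The kernel of the linear map
    [X -> (1 - P) X (1 - Q)] shows that the tangent vectors do form one. *)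
Lemma tangent_spaceE M X : \rank M = r ->
  X \in tangent_space r M <-> tangent_vector r M X.
Proof.
move=> rM; have [P [Q [K [K1 [PM PMK MQ QKM]]]]] := tangent_projectors rM.
rewrite /tangent_space /vspace_of; case: xgetP => [E _ /(_ X)//|none].
exfalso.
pose f : {linear 'M[R]_(l, m) -> 'M[R]_(l, m)} :=
  mulmxr (1%:M - Q) \o mulmx (1%:M - P).
apply: (none (lker (linfun f))) => Y; rewrite memv_ker lfunE/=.
by rewrite (tangent_vectorP Y rM PM PMK MQ QKM); split => [/eqP//|->].
Qed.

End TangentSpace.

(** * Orthogonal projection onto the tangent space *)

Section TangentProjection.
Variables (R : realType) (l m r : nat).
Implicit Types M N X : 'M[R]_(l, m).

Lemma tangent_spaceP (P : 'M[R]_l) (Q : 'M[R]_m) (K K1 : 'M[R]_(m, l)) M X :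
  \rank M = r -> P *m M = M -> P = M *m K -> M *m Q = M -> Q = K1 *m M ->
  X \in tangent_space r M <-> (1%:M - P) *m X *m (1%:M - Q) = 0.
Proof.
by move=> rM PM PMK MQ QKM; rewrite tangent_spaceE//;
  exact: (tangent_vectorP X rM PM PMK MQ QKM).
Qed.

(** For symmetric [P] and [Q], the factors [1 - P] and [1 - Q] of the residual can be moved across
    the trace onto a tangent [C], which they annihilate. *)
Lemma orth_proj_tangent (P : 'M[R]_l) (Q : 'M[R]_m) (K K1 : 'M[R]_(m, l)) M N :
  \rank M = r -> P *m M = M -> P = M *m K -> M *m Q = M -> Q = K1 *m M ->
  P^T = P -> Q^T = Q ->
  orth_proj (tangent_space r M) N = N - (1%:M - P) *m N *m (1%:M - Q).
Proof.
move=> rM PM PMK MQ QKM sP sQ.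
have TP := tangent_spaceP _ rM PM PMK MQ QKM.
have PP : (1%:M - P) *m (1%:M - P) = 1%:M - P.
  by rewrite mulmxBl mul1mx mulmxBr mulmx1 [P *m P](_ : _ = P) ?subrr ?subr0//
    {2}PMK mulmxA PM -PMK.
have QQ : (1%:M - Q) *m (1%:M - Q) = 1%:M - Q.
  by rewrite mulmxBl mul1mx mulmxBr mulmx1 [Q *m Q](_ : _ = Q) ?subrr ?subr0//
    {1}QKM -mulmxA MQ -QKM.
apply: orth_projP => [|C /TP TC].
  apply/TP; move: (1%:M - P) (1%:M - Q) PP QQ => p q pp qq.
  by rewrite mulmxBr mulmxBl !mulmxA pp -[_ *m q *m q]mulmxA qq subrr.
have sP' : (1%:M - P)^T = 1%:M - P by rewrite linearB/= trmx1 sP.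
have sQ' : (1%:M - Q)^T = 1%:M - Q by rewrite linearB/= trmx1 sQ.
rewrite opprB addrC subrK /frob !trmx_mul sP' sQ'.
by rewrite -mulmxA mxtrace_mulC -!mulmxA [_ *m (C *m _)]mulmxA TC mulmx0
  mxtrace0.
Qed.

End TangentProjection.

(** * Orthogonal projection onto the column space of a matrix of full column rank, and its
    derivative *)

Definition colspace_proj (R : realType) (p q : nat) (C : 'M[R]_(p, q)) :
  'M[R]_p :=
  C *m invmx (C^T *m C) *m C^T.

Lemma trmx_colspace_proj (R : realType) (p q : nat) (C : 'M[R]_(p, q)) :
  (colspace_proj C)^T = colspace_proj C.
Proof. by rewrite /colspace_proj !trmx_mul trmx_inv trmx_mul trmxK mulmxA. Qed.

Lemma colspace_projK (R : realType) (p q : nat) (C : 'M[R]_(p, q)) :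
  C^T *m C \in unitmx -> colspace_proj C *m C = C.
Proof. by move=> u; rewrite /colspace_proj -!mulmxA mulVmx// mulmx1. Qed.

Lemma derivable_colspace_proj (R : realType) (p q : nat) (F : R -> 'M[R]_(p,
  q)) (t : R) :
  derivable F t 1 -> (F t)^T *m F t \in unitmx ->
  derivable (fun x => colspace_proj (F x)) t 1.
Proof.
move=> /derivableP hF u; have hFT := is_derive_trmx hF.
have hI := is_derive_invmx (is_derive_mulmx hFT hF) u.
by case: (is_derive_mulmx (is_derive_mulmx hF hI) hFT).
Qed.

(** In the product rule, every term that keeps the last factor [(F t)^T] undifferentiated vanishes
    against [N]; a single term survives. *)
Lemma is_derive_colspace_proj (R : realType) (p q : nat) (F : R -> 'M[R]_(p,
  q)) dF
    (t : R) n (N : 'M[R]_(p, n)) :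
  is_derive t 1 F dF -> (F t)^T *m F t \in unitmx -> (F t)^T *m N = 0 ->
  is_derive t 1 (fun x => colspace_proj (F x) *m N)
    (F t *m invmx ((F t)^T *m F t) *m dF^T *m N).
Proof.
move=> hF u FN0; have hFT := is_derive_trmx hF.
have hI := is_derive_invmx (is_derive_mulmx hFT hF) u.
have := is_derive_mulmx (is_derive_mulmx (is_derive_mulmx hF hI) hFT)
  (is_derive_cst N t 1).
move=> /is_derive_eq; apply.
by rewrite /= mulmx0 addr0 mulmxDl -[_ *m (F t)^T *m N]mulmxA FN0 mulmx0 add0r.
Qed.

(** * Closed form of the Weingarten map *)

Section WeingartenFormula.
Variables (R : realType) (l m r : nat).
Variables (U : 'M[R]_(l, r)) (S : 'M[R]_r) (V : 'M[R]_(m, r)).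
Hypotheses (UU : U^T *m U = 1%:M) (VV : V^T *m V = 1%:M) (uS : S \in unitmx).

Let A := U *m S *m V^T.
Let B := U *m invmx S^T *m V^T.
Let P := U *m U^T.
Let Q := V *m V^T.

Let rankA : \rank A = r.
Proof.
apply/eqP; rewrite eqn_leq (rank_minor (W := U^T) (V := V)) ?andbT.
  by rewrite /A -mulmxA (leq_trans (mxrankM_maxl _ _))// rank_leq_col.
by rewrite /A !mulmxA UU mul1mx -mulmxA VV mulmx1.
Qed.

Lemma svd_tangent_spaceP (X : 'M[R]_(l, m)) :
  X \in tangent_space r A <-> (1%:M - P) *m X *m (1%:M - Q) = 0.
Proof.
(* The pseudoinverse of [A] serves as both [K] and [K1]. *)
apply: (@tangent_spaceP _ _ _ _ P Q (V *m invmx S *m U^T) (V *m invmx S *m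
  U^T)).
- exact: rankA.
- by rewrite /P /A !mulmxA -(mulmxA U) UU mulmx1.
- by rewrite /P /A -!mulmxA (mulmxA V^T) VV mul1mx (mulmxA S) mulmxV// mul1mx.
- by rewrite /Q /A -!mulmxA (mulmxA V^T) VV mul1mx.
- by rewrite /Q /A !mulmxA -(mulmxA _ U^T U) UU mulmx1 -(mulmxA V) mulVmx//
  mulmx1.
Qed.

Let mulmx_invmx_gram (T : 'M[R]_r) :
  T \in unitmx -> T *m invmx (T^T *m T) = invmx T^T.
Proof.
move=> uT; have uTT : T^T *m T \in unitmx by rewrite unitmx_mul unitmx_tr uT.
have uTt : T^T \in unitmx by rewrite unitmx_tr.
by rewrite -[LHS](mulKmx uTt) [T^T *m (T *m _)]mulmxA mulmxV// mulmx1.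
Qed.

(** Near 0 the projection of [N] is [P_t N + N Q_t - P_t N Q_t], with [P_t] and [Q_t] the
    projections onto the column and row spaces of [c t]. Both [P_0 N] and [N Q_0] vanish, so the
    cross term has zero derivative. *)
Lemma weingarten_formula (X N : 'M[R]_(l, m)) (c : R -> 'M[R]_(l, m)) :
  U^T *m N = 0 -> N *m V = 0 -> smooth_curve r A X c ->
  is_derive (0 : R) 1 (fun t => orth_proj (tangent_space r (c t)) N)
    (B *m X^T *m N + N *m X^T *m B).
Proof.
move=> UN NV [cnear c0 c'0].
have dc : is_derive (0 : R) 1 c X.
  rewrite -c'0 derive1E; apply: derivableP.
  by have [_ /(_ 0%N)] := nbhs_singleton cnear; rewrite derive1n0.
have dcst p q (C : 'M[R]_(p, q)) : is_derive (0 : R) 1 (cst C) 0 by exact: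
  is_derive_cst.
(* Moving bases of the column space and of the row space of [c t], valid while their Gram matrices
   stay invertible. *)
pose C t := c t *m V; pose D t := (c t)^T *m U.
have hC : is_derive (0 : R) 1 C (X *m V).
  by apply: is_derive_eq (is_derive_mulmx dc (dcst _ _ V)) _;
    rewrite mulmx0 addr0.
have hD : is_derive (0 : R) 1 D (X^T *m U).
  by apply: is_derive_eq (is_derive_mulmx (is_derive_trmx dc) (dcst _ _ U)) _;
    rewrite mulmx0 addr0.
have C0 : C 0 = U *m S by rewrite /C c0 /A -mulmxA VV mulmx1.
have D0 : D 0 = V *m S^T.
  by rewrite /D c0 /A !trmx_mul trmxK -!mulmxA UU mulmx1.
have CC0 : (C 0)^T *m C 0 = S^T *m S.
  by rewrite C0 trmx_mul -mulmxA (mulmxA U^T) UU mul1mx.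
have DD0 : (D 0)^T *m D 0 = S *m S^T.
  by rewrite D0 trmx_mul trmxK -mulmxA (mulmxA V^T) VV mul1mx.
have uCC : (C 0)^T *m C 0 \in unitmx by rewrite CC0 unitmx_mul unitmx_tr uS.
have uDD : (D 0)^T *m D 0 \in unitmx by rewrite DD0 unitmx_mul unitmx_tr uS.
have uH : U^T *m c 0 *m V \in unitmx.
  by rewrite -mulmxA -/(C 0) C0 mulmxA UU mul1mx.
have nCC := near_unitmx (@ex_derive _ _ _ _ _ _ _ (is_derive_mulmx
  (is_derive_trmx hC) hC)) uCC.
have nDD := near_unitmx (@ex_derive _ _ _ _ _ _ _ (is_derive_mulmx
  (is_derive_trmx hD) hD)) uDD.
have nH := near_unitmx (@ex_derive _ _ _ _ _ _ _ (is_derive_mulmx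
  (is_derive_mulmx (dcst _ _ U^T) dc) (dcst _ _ V))) uH.
(* [q] is the transpose of [N Q_t], so that the column space lemma covers both sides. *)
pose p t := colspace_proj (C t) *m N.
pose q t := colspace_proj (D t) *m N^T.
have CN : (C 0)^T *m N = 0 by rewrite C0 trmx_mul -mulmxA UN mulmx0.
have DN : (D 0)^T *m N^T = 0.
  by rewrite D0 trmx_mul trmxK -mulmxA -trmx_mul NV trmx0 mulmx0.
have hp : is_derive (0 : R) 1 p (B *m X^T *m N).
  apply: is_derive_eq (is_derive_colspace_proj hC uCC CN) _.
  by rewrite CC0 C0 trmx_mul -[U *m S *m _]mulmxA mulmx_invmx_gram// /B !mulmxA.
have hq : is_derive (0 : R) 1 q (B^T *m X *m N^T).
  apply: is_derive_eq (is_derive_colspace_proj hD uDD DN) _.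
  rewrite DD0 D0 trmx_mul trmxK -[V *m S^T *m _]mulmxA -{2}(trmxK S).
  by rewrite mulmx_invmx_gram ?unitmx_tr// /B !trmx_mul trmx_inv !trmxK !mulmxA.
have p0 : p 0 = 0 by rewrite /p /colspace_proj -!mulmxA CN !mulmx0.
have q0 : q 0 = 0 by rewrite /q /colspace_proj -!mulmxA DN !mulmx0.
have hQ := derivableP (derivable_colspace_proj (@ex_derive _ _ _ _ _ _ _ hD)
  uDD).
have hpQ := is_derive_mulmx hp hQ.
have hqT := is_derive_trmx hq.
apply: (near_eq_is_derive _ (is_derive_eq
  (is_deriveB (is_deriveD hp hqT) hpQ) (_ : _ = _))); last first.
  have BN : B *m X^T *m N *m colspace_proj (D 0) = 0.
    rewrite -mulmxA -[N *m _]trmxK trmx_mul trmx_colspace_proj -/(q 0) q0.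
    by rewrite trmx0 mulmx0.
  rewrite BN p0 mul0mx addr0 subr0 !trmx_mul !trmxK.
  by rewrite mulmxA.
near=> t.
have [rct _] : fixed_rank r (c t) /\ forall n, derivable (derive1n n c) t 1.
  by near: t.
have Ht : U^T *m c t *m V \in unitmx by near: t.
have Ct : (C t)^T *m C t \in unitmx by near: t.
have Dt : (D t)^T *m D t \in unitmx by near: t.
have DtT : (D t)^T = U^T *m c t by rewrite trmx_mul trmxK.
have sch := rank_schur rct Ht.
set H := invmx (U^T *m c t *m V) in sch.
rewrite (@orth_proj_tangent _ _ _ _ (colspace_proj (C t)) (colspace_proj (D t))
  (V *m invmx ((C t)^T *m C t) *m (C t)^T) (D t *m invmx ((D t)^T *m D t) *m
    U^T)).
- rewrite !fctE -/(p t) /q trmx_mul trmxK trmx_colspace_proj.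
  rewrite mulmxBl mul1mx mulmxBr mulmx1 mulmxBl -/(p t).
  move: (p t *m _) (N *m _) => a b.
  by apply/matrixP => i j; rewrite !mxE; ring.
- exact: rct.
(* By [sch], [c t] is [C t] times a matrix, so the projection onto the columns of [C t] fixes it;
   the row space is treated alike through [D t]. *)
- rewrite -[X in _ *m X = _]sch -/(C t) -[C t *m H *m _]mulmxA.
  by rewrite mulmxA colspace_projK// mulmxA; exact: sch.
- by rewrite /colspace_proj /C !mulmxA.
- rewrite -[X in X *m _ = _]sch -DtT -[_ *m (D t)^T *m _]mulmxA -[(D t)^T *m
  _]trmxK trmx_mul trmxK.
  by rewrite trmx_colspace_proj colspace_projK// DtT.
- by rewrite /colspace_proj DtT mulmxA.
- exact: trmx_colspace_proj.
- exact: trmx_colspace_proj.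
Unshelve. all: by end_near. Qed.

End WeingartenFormula.

(** * Eigenspaces of an operator diagonalized by a biorthogonal family *)

Section SpectralFormula.
Variables (K : fieldType) (vT : vectType K) (I : finType).
Variables (L : 'End(vT)) (phi : I -> vT) (f : I -> {scalar vT}) (kappa : I ->
  K).
Hypothesis f_phi : forall p q, f p (phi q) = (p == q)%:R.
Hypothesis kappa_neq0 : forall p, kappa p != 0.
Hypothesis LE : forall x, L x = \sum_p (kappa p * f p x) *: phi p.

Let L_phi p : L (phi p) = kappa p *: phi p.
Proof.
rewrite LE (bigD1 p)//= f_phi eqxx mulr1 big1 ?addr0// => q qp.
by rewrite f_phi (negPf qp) mulr0 scale0r.
Qed.

Let f_L p x : f p (L x) = kappa p * f p x.
Proof.
rewrite LE linear_sum (bigD1 p)//= linearZ/= f_phi eqxx mulr1 big1 ?addr0// =>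
  q qp.
by rewrite linearZ/= f_phi eq_sym (negPf qp) mulr0.
Qed.

Let f_span p s x : p \notin s -> x \in <<[seq phi q | q <- s]>>%VS -> f p x = 0.
Proof.
elim: s x => [|q s IH] x /=; first by rewrite span_nil memv0 => _ /eqP ->;
  rewrite linear0.
rewrite inE negb_or => /andP[pq ps]; rewrite span_cons => /memv_addP[_
  /vlineP[a ->] [y ys ->]].
by rewrite linearD linearZ/= f_phi (negPf pq) mulr0 add0r IH.
Qed.

Let free_phi s : uniq s -> free [seq phi q | q <- s].
Proof.
elim: s => [|p s IH] /=; first by rewrite nil_free.
move=> /andP[ps us]; rewrite free_cons IH// andbT.
by apply/negP => /(f_span ps); rewrite f_phi eqxx; apply/eqP; rewrite oner_eq0.
Qed.

Lemma mem_leigenspace_spectral p : phi p \in passmx.leigenspace L (kappa p).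
Proof.
by rewrite /passmx.leigenspace memv_ker !lfun_simp L_phi subrr.
Qed.

(** An eigenvector [x] equals [c^-1 L x], hence lies in the span of the [phi p]; applying [f p] to
    [L x = c x] kills the coefficients with [kappa p != c]. *)
Lemma dim_leigenspace_spectral c : c != 0 ->
  \dim (passmx.leigenspace L c) = #|[pred p | kappa p == c]|.
Proof.
move=> c0; set s := enum [pred p | kappa p == c].
suff -> : passmx.leigenspace L c = <<[seq phi p | p <- s]>>%VS.
  by have /eqP -> := free_phi (enum_uniq [pred p | kappa p == c]);
    rewrite size_map -cardE.
apply/eqP; rewrite eqEsubv; apply/andP; split; last first.
  apply/span_subvP => _ /mapP[p + ->]; rewrite mem_enum inE => /eqP <-.
  exact: mem_leigenspace_spectral.
apply/subvP => x; rewrite /passmx.leigenspace memv_ker !lfun_simp subr_eq0 =>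
  /eqP Lx.
have -> : x = \sum_p (c^-1 * (kappa p * f p x)) *: phi p.
  rewrite -[LHS](scalerK c0) -Lx LE scaler_sumr.
  by apply: eq_bigr => p _; rewrite scalerA.
apply: memv_suml => p _; have [kc|kc] := eqVneq (kappa p) c.
  by rewrite memvZ// memv_span// map_f// mem_enum inE kc.
suff -> : f p x = 0 by rewrite !mulr0 scale0r mem0v.
have := f_L p x; rewrite Lx linearZ/= => /eqP.
by rewrite -subr_eq0 -mulrBl mulf_eq0 subr_eq0 eq_sym (negPf kc) => /eqP.
Qed.

(** Rank-nullity: as no [kappa p] vanishes, each [phi p] lies in the image of [L], which is
    therefore the span of this free family. *)
Lemma dim_lker_spectral : \dim {:vT} = (#|I| + \dim (lker L))%N.
Proof.
rewrite -(limg_ker_dim L {:vT}) capfv addnC; congr (_ + _)%N.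
suff -> : limg L = <<[seq phi p | p <- enum I]>>%VS.
  by have /eqP -> := free_phi (enum_uniq I); rewrite size_map -cardE.
apply/eqP; rewrite eqEsubv; apply/andP; split.
  apply/subvP => _ /memv_imgP[x _ ->]; rewrite LE.
  by apply: memv_suml => p _; rewrite memvZ// memv_span// map_f// mem_enum.
apply/span_subvP => _ /mapP[p _ ->].
rewrite -[phi p](scalerK (kappa_neq0 p)) -L_phi memvZ//.
exact: memv_img (memvf _).
Qed.

End SpectralFormula.

(** * Rank-one matrices *)

Section OuterProducts.
Variables (R : realType) (p q : nat).
Implicit Types (a c : 'cV[R]_p) (b d : 'cV[R]_q).

Lemma trmx_mul_frob a c : a^T *m c = (frob a c)%:M.
Proof. by rewrite [LHS]mx11_scalar /frob trace_mx11. Qed.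

Lemma frob_outer a c b d : frob (a *m b^T) (c *m d^T) = frob a c * frob b d.
Proof.
rewrite {1}/frob trmx_mul trmxK mulmxA -(mulmxA b) trmx_mul_frob mul_mx_scalar.
by rewrite -scalemxAl linearZ/= mxtrace_mulC [frob b d]frobC.
Qed.

Lemma outer_frob a b (X : 'M[R]_(p, q)) : b^T *m X^T *m a = (frob (a *m b^T)
  X)%:M.
Proof.
rewrite [LHS]mx11_scalar -trace_mx11; congr (_%:M).
by rewrite frobC /frob -mulmxA mxtrace_mulC mulmxA.
Qed.

Lemma sum_outer n (a : 'I_n -> 'cV[R]_p) (b : 'I_n -> 'cV[R]_q) (d : 'rV[R]_n) :
  (\matrix_(x, i) a i x 0) *m diag_mx d *m (\matrix_(x, i) b i x 0)^T =
  \sum_i d 0 i *: (a i *m (b i)^T).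
Proof.
apply/matrixP => x y; rewrite summxE mxE; apply: eq_bigr => i _.
rewrite mul_mx_diag !mxE big_ord_recl big_ord0 addr0 !mxE.
by ring.
Qed.

End OuterProducts.

(** * Spans of sets of vectors *)

Section SetSpan.
Variables (K : fieldType) (vT : vectType K) (S : set vT).

Lemma mem_set_span x : S x -> x \in set_span S.
Proof.
move=> Sx; apply/set_spanP; exists [:: x]; last by rewrite memv_span ?mem_head.
by move=> y; rewrite inE => /eqP ->.
Qed.

Lemma sub_set_span (E : {vspace vT}) :
  (forall x, S x -> x \in E) -> (set_span S <= E)%VS.
Proof.
move=> SE; apply/subvP => x /set_spanP[s Ss]; apply/subvP.
by apply/span_subvP => y /Ss/SE.
Qed.

End SetSpan.

(** * Principal curvatures and directions from the singular vectors *)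

Section SingularValues.
Variables (R : realType) (l m r k : nat).
Variables (rkl : (r + k <= l)%N) (rkm : (r + k <= m)%N).
Variables (sigma : 'I_(r + k) -> R).
Variables (u : 'I_l -> 'cV[R]_l) (v : 'I_m -> 'cV[R]_m).
Hypothesis u_orth : forall i j, frob (u i) (u j) = (i == j)%:R.
Hypothesis v_orth : forall i j, frob (v i) (v j) = (i == j)%:R.
Hypothesis sigma_gt0 : forall i, 0 < sigma i.

Local Notation u1 := (u1 rkl u).
Local Notation u2 := (u2 rkl u).
Local Notation v1 := (v1 rkm v).
Local Notation v2 := (v2 rkm v).
Local Notation sigma1 := (sigma1 sigma).
Local Notation sigma2 := (sigma2 sigma).
Local Notation Phi := (Phi rkl rkm u v).
Local Notation kappa := (kappa sigma).

Variables A N : 'M[R]_(l, m).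
Hypothesis A_svd : A = \sum_(i < r) sigma1 i *: (u1 i *m (v1 i)^T).
Hypothesis N_svd : N = \sum_(j < k) sigma2 j *: (u2 j *m (v2 j)^T).
Hypothesis rankA : \rank A = r.

Let U1 : 'M[R]_(l, r) := \matrix_(x, i) u1 i x 0.
Let V1 : 'M[R]_(m, r) := \matrix_(x, i) v1 i x 0.
Let S : 'M[R]_r := diag_mx (\row_i sigma1 i).

Let AE : A = U1 *m S *m V1^T.
Proof. by rewrite A_svd sum_outer; apply: eq_bigr => i _; rewrite mxE. Qed.

Let sigma1_neq0 i : sigma1 i != 0.
Proof. by rewrite gt_eqF//; exact: sigma_gt0. Qed.

Let S_inv : S *m diag_mx (\row_i (sigma1 i)^-1) = 1%:M.
Proof.
rewrite mulmx_diag; apply/matrixP => i j; rewrite !mxE; case: eqP => // _.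
by rewrite mulfV.
Qed.

Let unitS : S \in unitmx.
Proof. by have [] := mulmx1_unit S_inv. Qed.

Let B := U1 *m invmx S^T *m V1^T.

Let BE : B = \sum_i (sigma1 i)^-1 *: (u1 i *m (v1 i)^T).
Proof.
rewrite /B tr_diag_mx (_ : invmx S = diag_mx (\row_i (sigma1 i)^-1)).
  by rewrite sum_outer; apply: eq_bigr => i _; rewrite mxE.
by rewrite -[LHS]mulmx1 -S_inv mulmxA mulVmx// mul1mx.
Qed.

Let frob_u11 i j : frob (u1 i) (u1 j) = (i == j)%:R.
Proof. by rewrite u_orth. Qed.
Let frob_u22 i j : frob (u2 i) (u2 j) = (i == j)%:R.
Proof. by rewrite u_orth -val_eqE/= eqn_add2l. Qed.
Let frob_u12 i j : frob (u1 i) (u2 j) = 0.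
Proof. by rewrite u_orth -val_eqE/= ltn_eqF// ltn_addr. Qed.
Let frob_v11 i j : frob (v1 i) (v1 j) = (i == j)%:R.
Proof. by rewrite v_orth. Qed.
Let frob_v22 i j : frob (v2 i) (v2 j) = (i == j)%:R.
Proof. by rewrite v_orth -val_eqE/= eqn_add2l. Qed.
Let frob_v12 i j : frob (v1 i) (v2 j) = 0.
Proof. by rewrite v_orth -val_eqE/= ltn_eqF// ltn_addr. Qed.

Let col_U1 i : col i U1 = u1 i.
Proof. by apply/matrixP => x y; rewrite !mxE ord1. Qed.
Let col_V1 i : col i V1 = v1 i.
Proof. by apply/matrixP => x y; rewrite !mxE ord1. Qed.

Let UU : U1^T *m U1 = 1%:M.
Proof.
apply/matrixP => i j; rewrite !mxE -frob_u11 frobE; apply: eq_bigr => x _.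
by rewrite big_ord_recl big_ord0 addr0 !mxE.
Qed.

Let VV : V1^T *m V1 = 1%:M.
Proof.
apply/matrixP => i j; rewrite !mxE -frob_v11 frobE; apply: eq_bigr => x _.
by rewrite big_ord_recl big_ord0 addr0 !mxE.
Qed.

Let u1N i : (u1 i)^T *m N = 0.
Proof.
rewrite N_svd mulmx_sumr big1// => j _; rewrite -scalemxAr mulmxA trmx_mul_frob
  frob_u12.
by rewrite raddf0 mul0mx scaler0.
Qed.

Let Nv1 i : N *m v1 i = 0.
Proof.
rewrite N_svd mulmx_suml big1// => j _; rewrite -scalemxAl -mulmxA
  trmx_mul_frob frobC frob_v12.
by rewrite raddf0 mulmx0 scaler0.
Qed.

Let UN : U1^T *m N = 0.
Proof. by apply/row_matrixP => i; rewrite row_mul -tr_col col_U1 u1N row0. Qed.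

Let NV : N *m V1 = 0.
Proof.
apply/matrixP => x i; have /matrixP/(_ x 0) := Nv1 i.
by rewrite -col_V1 colE mulmxA -colE !mxE.
Qed.

Let T := tangent_space r A.
Let P := U1 *m U1^T.
Let Q := V1 *m V1^T.

Let memT X : X \in T <-> (1%:M - P) *m X *m (1%:M - Q) = 0.
Proof. by rewrite /T AE; exact: svd_tangent_spaceP. Qed.

Let Pu1 i : (1%:M - P) *m u1 i = 0.
Proof.
by rewrite -col_U1 colE mulmxA mulmxBl mul1mx -(mulmxA U1) UU mulmx1 subrr
  mul0mx.
Qed.

Let v1Q i : (v1 i)^T *m (1%:M - Q) = 0.
Proof.
rewrite -col_V1 tr_col -row_mul mulmxBr mulmx1 mulmxA VV mul1mx subrr.
by rewrite row0.
Qed.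

Let Phi_T s i j : Phi s i j \in T.
Proof.
apply/memT; move: (1%:M - P) (1%:M - Q) (Pu1 i) (v1Q i) => p q pu1 v1q.
rewrite /Defs.Phi -scalemxAr mulmxDr -scalemxAr !mulmxA pu1 mul0mx scaler0
  addr0.
by rewrite -scalemxAl -!mulmxA v1q !mulmx0 scaler0.
Qed.

Let I := (bool * 'I_r * 'I_k)%type.
Let PhiI (p : I) := Phi p.1.1 p.1.2 p.2.
Let kappaI (p : I) := kappa p.1.1 p.1.2 p.2.

Let half : (Num.sqrt 2)^-1 * (Num.sqrt 2)^-1 = 2^-1 :> R.
Proof. by rewrite -invfM -expr2 sqr_sqrtr. Qed.

(** The mixed products vanish because [u1] and [u2] are orthogonal. The other two add up to
    [(1 + (-1)^(s+s')) / 2] when the indices agree, which is 1 or 0 according to the signs. *)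
Lemma frob_Phi (p q : bool * 'I_r * 'I_k) :
  frob (Phi p.1.1 p.1.2 p.2) (Phi q.1.1 q.1.2 q.2) = (p == q)%:R.
Proof.
case: p q => [[s i] j] [[s' i'] j'] /=.
rewrite /Defs.Phi frobZl frobZr mulrA half !(frobDl, frobDr, frobZl, frobZr)
  !frob_outer.
rewrite frob_u11 frob_v11 frob_u22 frob_v22 (frobC (u2 _)) !frob_u12 !mul0r
  !mulr0.
rewrite !addr0 add0r !xpair_eqE.
by case: s s' (i == i') (j == j') => [] [] [] [] /=; rewrite ?expr0 ?expr1;
  field.
Qed.

Let kappa_neq0 (p : I) : kappaI p != 0.
Proof.
by rewrite mulf_neq0 ?signr_eq0// mulf_neq0 ?invr_neq0// gt_eqF//;
  exact: sigma_gt0.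
Qed.

Let W (X : 'M[R]_(l, m)) := B *m X^T *m N + N *m X^T *m B.

Let BXN X : B *m X^T *m N = \sum_i \sum_j
  (sigma2 j / sigma1 i * frob (u2 j *m (v1 i)^T) X) *: (u1 i *m (v2 j)^T).
Proof.
rewrite BE N_svd !mulmx_suml; apply: eq_bigr => i _; rewrite mulmx_sumr.
apply: eq_bigr => j _; rewrite -!scalemxAl -scalemxAr scalerA -!mulmxA.
rewrite (mulmxA X^T) (mulmxA (v1 i)^T) (mulmxA (v1 i)^T) outer_frob
  mul_scalar_mx.
by rewrite -scalemxAr scalerA; congr (_ *: _);
  rewrite mulrAC mulrC -mulrA mulrC -!mulrA mulrCA.
Qed.

Let NXB X : N *m X^T *m B = \sum_i \sum_j
  (sigma2 j / sigma1 i * frob (u1 i *m (v2 j)^T) X) *: (u2 j *m (v1 i)^T).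
Proof.
rewrite BE N_svd mulmx_sumr; apply: eq_bigr => i _; rewrite !mulmx_suml.
apply: eq_bigr => j _; rewrite -!scalemxAl -scalemxAr scalerA -!mulmxA.
rewrite (mulmxA X^T) (mulmxA (v2 j)^T) (mulmxA (v2 j)^T) outer_frob
  mul_scalar_mx.
by rewrite -scalemxAr scalerA.
Qed.

(** For fixed i and j, put [a = u2 v1^T] and [b = u1 v2^T]. By [BXN] and [NXB], [W] acts on their
    span as a multiple of the swap of [a] and [b], whose eigenvectors [a + b] and [a - b] have
    eigenvalues 1 and -1. *)
Let WE X : W X = \sum_p (kappaI p * frob (PhiI p) X) *: PhiI p.
Proof.
pose G s i j := (kappa s i j * frob (Phi s i j) X) *: Phi s i j.
have -> : \sum_p (kappaI p * frob (PhiI p) X) *: PhiI p =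
    \sum_i \sum_j (G false i j + G true i j).
  rewrite -(pair_bigA _ (fun q j => G q.1 q.2 j)) -(pair_bigA _ (fun s i =>
    \sum_j G s i j)).
  rewrite big_bool /= addrC -big_split; apply: eq_bigr => i _.
  by rewrite -big_split.
rewrite /W BXN NXB -big_split; apply: eq_bigr => i _ /=.
rewrite -big_split; apply: eq_bigr => j _ /=; rewrite /G /Defs.Phi /Defs.kappa.
rewrite !frobZl !frobDl !frobZl expr0 expr1.
move: half (frob _ X) (frob _ X) => + fb fa.
move: (Num.sqrt 2)^-1 (sigma2 j / sigma1 i) (u2 j *m _) (u1 i *m _) => c rho a
  b cc.
apply/matrixP => x y; rewrite !mxE; move: (a x y) (b x y) => axy bxy.
(* Isolates [c * c], so that the square of [1 / sqrt 2] can be replaced by [1 / 2]. *)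
transitivity (c * c * (2 * rho * (fa * bxy + fb * axy))); last by ring.
by rewrite cc; field.
Qed.

Let W_T X : W X \in T.
Proof. by rewrite WE; apply: memv_suml => p _; apply: memvZ; exact: Phi_T. Qed.

Let L := weingarten r A N.

Let W_derive X c : smooth_curve r A X c ->
  is_derive (0 : R) 1 (fun t => orth_proj (tangent_space r (c t)) N) (W X).
Proof. by rewrite AE; exact: weingarten_formula. Qed.

(** [weingarten] is chosen by [xget], so a witness is needed: [W] is linear and maps into [T], hence
    [vsproj] does not alter its values. *)
Lemma weingarten_svd : is_weingarten r A N (weingarten r A N).
Proof.
pose g (X : subvs_of T) : subvs_of T := vsproj T (W (vsval X)).
have g_lin : linear g.
  move=> a X Y; rewrite /g -linearP; congr (vsproj T _).
  have -> : vsval (a *: X + Y) = a *: vsval X + vsval Y by rewrite linearP.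
  move: (vsval X) (vsval Y) => x y; rewrite /W.
  have -> : (a *: x + y)^T = a *: x^T + y^T by rewrite linearP.
  rewrite !mulmxDr !mulmxDl -!scalemxAr -!scalemxAl scalerDr.
  by rewrite addrACA.
pose gL : {linear subvs_of T -> subvs_of T} :=
  HB.pack g (GRing.isLinear.Build _ _ _ _ g g_lin).
rewrite /weingarten; case: xgetP => [//|/(_ (linfun gL)) []] X c /W_derive.
by rewrite lfunE/= vsprojK.
Qed.

(** Every tangent vector is the velocity of some curve, and uniqueness of the derivative along it
    determines [L]. *)
Let LE X : vsval (L X) = W (vsval X).
Proof.
have [c sc] := (tangent_spaceE _ rankA).1 (subvsP X).
have [_ <-] := weingarten_svd sc.
by have [_ <-] := W_derive sc.
Qed.

Let phi (p : I) : subvs_of T := vsproj T (PhiI p).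

Let phiE p : vsval (phi p) = PhiI p.
Proof. by rewrite /phi vsprojK//; exact: Phi_T. Qed.

Let f0 (p : I) (X : subvs_of T) : R := frob (PhiI p) (vsval X).

Let f0_lin p : scalar (f0 p).
Proof. by move=> a X Y; rewrite /f0 linearP/= frobDr frobZr. Qed.

Let f (p : I) : {scalar subvs_of T} :=
  HB.pack (f0 p) (GRing.isLinear.Build _ _ _ _ (f0 p) (f0_lin p)).

Let f_phi p q : f p (phi q) = (p == q)%:R.
Proof. by rewrite /f/= /f0 phiE; exact: frob_Phi. Qed.

Let L_spectral X : L X = \sum_p (kappaI p * f p X) *: phi p.
Proof.
apply: subvs_inj; rewrite LE WE linear_sum; apply: eq_bigr => p _.
by rewrite [RHS]linearZ/= phiE.
Qed.

Lemma dim_leigenspace_weingarten c : c != 0 ->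
  \dim (passmx.leigenspace (weingarten r A N) c) =
  count_mem c [seq kappa p.1.1 p.1.2 p.2 | p <- enum {: bool * 'I_r * 'I_k}].
Proof.
move=> c0; rewrite (dim_leigenspace_spectral f_phi L_spectral c0).
by rewrite count_map -size_filter cardE enumT.
Qed.

Lemma Phi_leigenspace_weingarten s i j :
  Phi s i j \in ambient (passmx.leigenspace (weingarten r A N) (kappa s i j)).
Proof.
apply/memv_imgP; exists (phi (s, i, j)); last by rewrite lfunE/= phiE.
exact: (mem_leigenspace_spectral f_phi L_spectral (s, i, j)).
Qed.

Lemma dim_tangent_space_weingarten :
  \dim (tangent_space r A) = (2 * k * r + \dim (lker (weingarten r A N)))%N.
Proof.
have := dim_lker_spectral f_phi kappa_neq0 L_spectral.
rewrite !card_prod card_bool !card_ord mulnAC => <-.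
by rewrite dimvf.
Qed.

Let mem_ker X : X \in ambient (lker L) <-> X \in T /\ W X = 0.
Proof.
split=> [/memv_imgP[Y] | [XT WX]].
  rewrite memv_ker => /eqP LY ->; rewrite lfunE/=; split; first exact: subvsP.
  by rewrite -LE LY linear0.
apply/memv_imgP; exists (vsproj T X); last by rewrite lfunE/= vsprojK.
by rewrite memv_ker; apply/eqP/subvs_inj; rewrite LE vsprojK// WX linear0.
Qed.

(** * The kernel of the Weingarten map *)

Variables (U : 'M[R]_(l, r)) (Z : 'M[R]_(m, r)).
Hypotheses (A_UZ : A = U *m Z^T) (Z_rank : \rank Z = r).

(** [U] and [U1] both span the column space of [A], because [Z] has full rank and [S] is invertible;
    so they have the same left annihilator. *)
Let U1_U (w : 'cV[R]_l) : w^T *m U1 = 0 <-> w^T *m U = 0.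
Proof.
have wA : w^T *m A = 0 <-> w^T *m U1 = 0.
  rewrite AE !mulmxA; split=> [wA|->]; last by rewrite !mul0mx.
  have := congr1 (fun M => M *m (V1 *m invmx S)) wA.
  by rewrite mul0mx mulmxA -(mulmxA _ V1^T) VV mulmx1 -mulmxA mulmxV// mulmx1.
rewrite -wA A_UZ mulmxA; split=> [wUZ|->]; last by rewrite mul0mx.
have fZ : row_free Z^T by rewrite /row_free mxrank_tr Z_rank.
by rewrite -[LHS]mulmx1 -(mulmxVp fZ) mulmxA wUZ mul0mx.
Qed.

Local Notation K1 :=
  (set_span [set X : 'M[R]_(l, m) | exists (i : 'I_r) (w : 'cV[R]_m),
     N *m w = 0 /\ X = u1 i *m w^T]).
Local Notation K2 :=
  (set_span [set X : 'M[R]_(l, m) | exists (i : 'I_r) (w : 'cV[R]_l),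
     [/\ w^T *m N = 0, w^T *m U = 0 & X = w *m (v1 i)^T]]).

Let PE : P = \sum_i u1 i *m (u1 i)^T.
Proof.
transitivity (U1 *m diag_mx (const_mx 1) *m U1^T);
  first by rewrite diag_const_mx mulmx1.
by rewrite sum_outer; apply: eq_bigr => i _; rewrite mxE scale1r.
Qed.

Let QE : Q = \sum_i v1 i *m (v1 i)^T.
Proof.
transitivity (V1 *m diag_mx (const_mx 1) *m V1^T);
  first by rewrite diag_const_mx mulmx1.
by rewrite sum_outer; apply: eq_bigr => i _; rewrite mxE scale1r.
Qed.

Let P_K1 X : X \in K1 -> (1%:M - P) *m X = 0.
Proof.
suff : (K1 <= lker (linfun (mulmx (1%:M - P) : 'M[R]_(l, m) -> 'M[R]_(l,
  m))))%VS.
  by move=> /subvP + XK => /(_ X XK); rewrite memv_ker lfunE => /eqP.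
apply: sub_set_span => _ [i [w [_ ->]]].
by rewrite memv_ker lfunE/= mulmxA Pu1 mul0mx.
Qed.

Let P_K2 X : X \in K2 -> P *m X = 0.
Proof.
suff : (K2 <= lker (linfun (mulmx P : 'M[R]_(l, m) -> 'M[R]_(l, m))))%VS.
  by move=> /subvP + XK => /(_ X XK); rewrite memv_ker lfunE => /eqP.
apply: sub_set_span => _ [i [w [_ /U1_U wU ->]]].
have Pw : U1^T *m w = 0 by apply: trmx_inj; rewrite trmx_mul trmxK wU trmx0.
by rewrite memv_ker lfunE/= mulmxA -(mulmxA U1) Pw mulmx0 mul0mx.
Qed.

(** [P] is the identity on [K1] and zero on [K2]. *)
Lemma directv_kernel : directv (K1 + K2)%VS.
Proof.
apply/directv_addP/eqP; rewrite -subv0; apply/subvP => X.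
rewrite memv_cap memv0 => /andP[/P_K1 + /P_K2 PX].
by rewrite mulmxBl mul1mx PX subr0 => ->.
Qed.

Let ker_K1 i (w : 'cV[R]_m) : N *m w = 0 -> u1 i *m w^T \in ambient (lker L).
Proof.
move=> Nw; apply/mem_ker; split.
  by apply/memT; rewrite mulmxA Pu1 !mul0mx.
rewrite /W trmx_mul trmxK !mulmxA Nw !mul0mx addr0.
by rewrite -mulmxA u1N mulmx0.
Qed.

Let ker_K2 i (w : 'cV[R]_l) : w^T *m N = 0 -> w^T *m U = 0 ->
  w *m (v1 i)^T \in ambient (lker L).
Proof.
move=> wN wU; apply/mem_ker; split.
  by apply/memT; rewrite -!mulmxA v1Q !mulmx0.
rewrite /W trmx_mul trmxK !mulmxA Nv1 !mul0mx addr0.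
by rewrite -mulmxA wN mulmx0.
Qed.

Let PB : (1%:M - P) *m B = 0.
Proof.
rewrite BE mulmx_sumr big1// => i _.
by rewrite -scalemxAr mulmxA Pu1 mul0mx scaler0.
Qed.

Let PN : P *m N = 0.
Proof. by rewrite /P -mulmxA UN mulmx0. Qed.

(** Multiplying [W X] by [1 - P] kills the term starting with [B] and keeps the one starting with
    [N], so both terms vanish separately. The factors of [B] beside [U1] or [V1] are then
    cancelled. *)
Let W_eq0 X : W X = 0 -> N *m X^T *m U1 = 0 /\ V1^T *m X^T *m N = 0.
Proof.
move=> WX; have NXB0 : N *m X^T *m B = 0.
  have := congr1 (mulmx (1%:M - P)) WX; rewrite /W mulmx0.
  rewrite [(1%:M - P) *m (_ + _)]mulmxDr.
  rewrite (mulmxA _ (B *m X^T)) (mulmxA _ B) PB !mul0mx add0r !mulmxA.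
  by rewrite [_ *m N]mulmxBl mul1mx PN subr0.
move: WX; rewrite /W NXB0 addr0 => BXN0; split.
  have := congr1 (fun M => M *m (V1 *m S^T)) NXB0.
  rewrite mul0mx /B !mulmxA -(mulmxA _ V1^T) VV mulmx1 => <-.
  by rewrite -[RHS]mulmxA mulVmx ?unitmx_tr// mulmx1.
have := congr1 (mulmx (S^T *m U1^T)) BXN0.
rewrite mulmx0 /B !mulmxA -(mulmxA _ U1^T) UU mulmx1.
by rewrite mulmxV ?unitmx_tr// mul1mx.
Qed.

Lemma ambient_lker_weingarten :
  ambient (lker (weingarten r A N)) = (K1 + K2)%VS.
Proof.
apply/eqP; rewrite eqEsubv; apply/andP; split; last first.
  rewrite subv_add; apply/andP; split.
    by apply: sub_set_span => _ [i [w [Nw ->]]]; exact: ker_K1.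
  by apply: sub_set_span => _ [i [w [wN wU ->]]]; exact: ker_K2.
apply/subvP => X /mem_ker[/memT XT /W_eq0[NXU VXN]].
(* Tangency splits [X] into a [K1] part and a [K2] part; expanding [P] and [Q] into rank-one terms
   gives the vectors [w] below, and [W_eq0] the conditions on them involving [N]. *)
have -> : X = P *m X + (1%:M - P) *m X *m Q.
  move/eqP: XT; rewrite [_ *m (1%:M - Q)]mulmxBr mulmx1 subr_eq0 => /eqP <-.
  by rewrite mulmxBl mul1mx addrC subrK.
apply: memv_add.
  rewrite PE mulmx_suml; apply: memv_suml => i _; apply: mem_set_span.
  exists i, (X^T *m u1 i); split; last by rewrite trmx_mul trmxK mulmxA.
  by rewrite -col_U1 colE !mulmxA NXU mul0mx.
rewrite QE mulmx_sumr; apply: memv_suml => i _; apply: mem_set_span.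
exists i, ((1%:M - P) *m X *m v1 i); split; last by rewrite mulmxA.
- have sP : (1%:M - P)^T = 1%:M - P by rewrite linearB/= trmx1 trmx_mul trmxK.
  rewrite !trmx_mul sP -!mulmxA [_ *m N]mulmxBl mul1mx PN subr0.
  by rewrite -col_V1 tr_col rowE -!mulmxA (mulmxA V1^T) VXN mulmx0.
- apply/U1_U; rewrite -[U1]trmxK -trmx_mul mulmxA mulmxA.
  by rewrite [_ *m (1%:M - P)]mulmxBr mulmx1 mulmxA UU mul1mx subrr !mul0mx
    trmx0.
Qed.

End SingularValues.

Theorem theorem4p5 (R : realType) (l m r k : nat)
  (rkl : (r + k <= l)%N) (rkm : (r + k <= m)%N)
  (U : 'M[R]_(l, r)) (Z : 'M[R]_(m, r)) (A N : 'M[R]_(l, m))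
  (sigma : 'I_(r + k) -> R)
  (u : 'I_l -> 'cV[R]_l) (v : 'I_m -> 'cV[R]_m)
  (U_orth : U^T *m U = 1%:M) (Z_rank : \rank Z = r)
  (A_rank : fixed_rank r A)
  (A_UZ : A = U *m Z^T)
  (N_normal : normal_directions U Z N) (N_rank : \rank N = k)
  (u_basis : orthonormal_basis u) (v_basis : orthonormal_basis v)
  (sigma_gt0 : forall i, 0 < sigma i)
  (A_svd : A = \sum_(i < r) sigma1 sigma i *: (u1 rkl u i *m (v1 rkm v i)^T))
  (N_svd : N = \sum_(j < k) sigma2 sigma j *: (u2 rkl u j *m (v2 rkm v j)^T)) :
  let T := tangent_space r A in
  let L := weingarten r A N in
  let curvatures := [seq kappa sigma p.1.1 p.1.2 p.2
                    | p <- enum {: bool * 'I_r * 'I_k}] in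
  let K1 := set_span [set X : 'M[R]_(l, m) | exists (i : 'I_r) (w : 'cV[R]_m),
              N *m w = 0 /\ X = u1 rkl u i *m w^T] in
  let K2 := set_span [set X : 'M[R]_(l, m) | exists (i : 'I_r) (w : 'cV[R]_l),
              [/\ w^T *m N = 0, w^T *m U = 0 & X = w *m (v1 rkm v i)^T]] in
  (* T is the tangent space at A, and L the Weingarten map, along any curve *)
  [/\ forall X, X \in T <-> tangent_vector r A X
    & is_weingarten r A N L] /\
  (* the non-zero principal curvatures, counted with multiplicity (the
     dimension of the eigenspace) *)
  [/\ size curvatures = (2 * k * r)%N,
      0 \notin curvatures
    & forall c, c != 0 -> \dim (passmx.leigenspace L c) = count_mem c curvatures] /\
  (* the normalized principal directions *)
  (forall (s : bool) (i : 'I_r) (j : 'I_k),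
     let phi := Phi rkl rkm u v s i j in
     phi \in ambient (passmx.leigenspace L (kappa sigma s i j)) /\
     frob phi phi = 1) /\
  (* the other principal curvatures are zero, with principal subspace Ker L *)
  [/\ \dim T = (2 * k * r + \dim (lker L))%N,
      ambient (lker L) = (K1 + K2)%VS
    & directv (K1 + K2)%VS].
Proof.
move=> T L curvatures K1 K2; case: u_basis v_basis => [u_orth _] [v_orth _].
have w := weingarten_svd u_orth v_orth sigma_gt0 A_svd N_svd.
have dimL := dim_leigenspace_weingarten u_orth v_orth sigma_gt0 A_svd N_svd A_rank.
split; [|split; [|split]].
- by split=> [X|]; [exact: tangent_spaceE|exact: w].
- split; [| |exact: dimL].
    by rewrite size_map -cardE !card_prod card_bool !card_ord mulnAC.
  apply/mapP => -[p _ /eqP]; apply/negP; rewrite eq_sym.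
  by rewrite mulf_neq0 ?signr_eq0// mulf_neq0 ?invr_neq0// gt_eqF//; exact: sigma_gt0.
- move=> s i j; split.
    exact: (Phi_leigenspace_weingarten u_orth v_orth sigma_gt0 A_svd N_svd A_rank).
  have := frob_Phi rkl rkm u_orth v_orth (s, i, j) (s, i, j).
  by rewrite eqxx.
- split.
  + exact: (dim_tangent_space_weingarten u_orth v_orth sigma_gt0 A_svd N_svd A_rank).
  + exact: (ambient_lker_weingarten u_orth v_orth sigma_gt0 A_svd N_svd A_rank A_UZ Z_rank).
  + exact: (directv_kernel u_orth v_orth sigma_gt0 N A_svd A_UZ Z_rank).
Qed.
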